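(* Let $d=1$ and suppose that $\lambda_1>\lambda_2$. Consider the problem of finding $v\in V$ with $v\in M_{\mathcal E}$, where $M_{\mathcal E}$ is the set of local minimizers of the energy $\mathcal E:V\to\mathbb R$. If $\mathrm{Vol}^0(\Sigma_{\mathrm v})=0$, then this problem has a solution. If instead $\mathrm{Vol}^0(\Sigma_{\mathrm v})>0$, then this problem has a unique solution.
   Context: Domain ($d=1$): $\Omega\subset\mathbb R$ is a bounded open interval; $\Sigma_{\mathrm v},\Sigma_{\mathrm p}\subset\partial\Omega$ are disjoint subsets of the two-point boundary with $\partial\Omega=\Sigma_{\mathrm v}\cup\Sigma_{\mathrm p}$. $\mathrm{Vol}^{0}$ denotes $0$-dimensional (counting) measure, so $\mathrm{Vol}^0(A)=0$ means $A=\emptyset$; integrals over $\Sigma_{\mathrm v}$ are sums. Exponents and spaces: $r\ge2$, $s=\frac{r}{r-1}$, and $\langle g,\varphi\rangle=\int_\Omega g\varphi$ for $g\in L^s(\Omega)$, $\varphi\in L^r(\Omega)$. Set $W_0^{1,s}(\Omega)=\{\xi\in W^{1,s}(\Omega):\int_\Omega\xi=0\}$ if $\mathrm{Vol}^{0}(\Sigma_{\mathrm p})=0$, and $W_0^{1,s}(\Omega)=\{\xi\in W^{1,s}(\Omega):\xi=0\text{ on }\Sigma_{\mathrm p}\}$ if $\mathrm{Vol}^{0}(\Sigma_{\mathrm p})>0$. Set $V=\{\varphi\in L^r(\Omega):\langle\psi',\varphi\rangle=0\ \text{for all }\psi\in W_0^{1,s}(\Omega)\}$. Data: $q\in L^r(\Omega)$,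 $u_0:\Sigma_{\mathrm v}\to\mathbb R$, $f_0\in L^s(\Omega)$ are given. $\hat u\in L^r(\Omega)$ is a fixed function with $\langle\psi',\hat u\rangle=-\int_\Omega q\psi+\int_{\Sigma_{\mathrm v}}u_0\psi$ for all $\psi\in W_0^{1,s}(\Omega)$ (such a function exists and is unique modulo $V$). Constitutive functions: $\phi_1,\phi_2:[0,\infty)\to[0,\infty)$; $\phi_1$ is continuous and increasing (in the non-strict sense) on $[0,1]$; $\phi_2$ is continuous and increasing (in the non-strict sense) on $[1,\infty)$; there are $c,C>0$ with $c\,a^{\frac{r-2}{2}}\le\phi_2(a)\le C\bigl(1+a^{\frac{r-2}{2}}\bigr)$ for all $a\ge1$. Set $\lambda_1=\phi_1(1)$, $\lambda_2=\phi_2(1)$. Energy: let $\Phi_1(a)=\frac12\int_1^a\phi_1$ for $0\le a\le1$ and $\Phi_2(a)=\frac12\int_1^a\phi_2$ for $a\ge1$ (so $\Phi_1(1)=\Phi_2(1)=0$). Let $\Psi:[0,\infty)\to\mathbb R$ be $\Psi(a)=\Phi_1(a)$ for $a\le1$ and $\Psi(a)=\Phi_2(a)$ for $a>1$. The dissipation is $\mathcal D(v)=\int_\Omega\Psi((v+\hat u)^2)$ and the energy is $\mathcal E(v)=\mathcal D(v)-\langle f_0,v+\hat u\rangle$ for $v\in V$. Local minimizer: $v\in V$ is a (strong) local minimizer of $\mathcal F:V\to\mathbb R$ if there exists $\eta>0$ such that for all $\varphi\in V$ one has $\mathcal F(v+\delta\varphi)\ge\mathcal F(v)$ for all $\delta\in[0,\eta)$.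 *)

(* Defs.v *)
From mathcomp Require Import all_boot all_order all_algebra.
From mathcomp Require Import all_classical all_reals all_analysis.
Import Order.TTheory GRing.Theory Num.Theory.
Import numFieldNormedType.Exports.

Set Implicit Arguments.
Unset Strict Implicit.
Unset Printing Implicit Defensive.

Local Open Scope classical_set_scope.
Local Open Scope ring_scope.

Section Defs.
Context {R : realType}.
Implicit Types (a b r s x : R) (D : set R) (f g v : R -> R).

Local Notation mu := (@lebesgue_measure R).

(* Elements of L^p(D) are represented by functions R -> R, of which only the
   values on D matter (f \_ D is the extension of f by zero); elements are
   identified up to equality almost everywhere on D. *)
Definition Lp D (p : R) : set (R -> R) :=
  [set f | f \_ D \in Lfun mu p%:E].

Definition pairing D g f : R := \int[mu]_(x in D) (g x * f x).

Definition conj_exp r : R := r / (r - 1).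

(* chi belongs to C^infty_c(D) *)
Definition test_function D (chi : R -> R) : Prop :=
  let supp := closure [set x | chi x != 0] in
  [/\ forall n x, derivable (derive1n n chi) x 1,
      compact supp & supp `<=` D].

Definition weak_derivative D (xi dxi : R -> R) : Prop :=
  forall chi, test_function D chi ->
    \int[mu]_(x in D) (xi x * derive1 chi x) = - \int[mu]_(x in D) (dxi x * chi x).

(* xi belongs to W^{1,s}(]a, b[), with weak derivative dxi.  In dimension one
   a Sobolev class has a unique representative that is continuous on [a, b];
   we require xi to be that representative, so that its boundary values are
   xi a and xi b. *)
Definition W1 a b s (xi dxi : R -> R) : Prop :=
  [/\ {within `[a, b], continuous xi},
      Lp `]a, b[ s xi, Lp `]a, b[ s dxi & weak_derivative `]a, b[ xi dxi].

Definition Vol0 (A : set R) : \bar R := counting A.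

Definition W10 a b (Sp : set R) s (xi dxi : R -> R) : Prop :=
  [/\ W1 a b s xi dxi,
      Vol0 Sp = 0%E -> \int[mu]_(x in `]a, b[) xi x = 0 &
      (0 < Vol0 Sp)%E -> forall x, Sp x -> xi x = 0].

Definition V a b (Sp : set R) r : set (R -> R) :=
  [set phi | Lp `]a, b[ r phi /\
     forall psi dpsi, W10 a b Sp (conj_exp r) psi dpsi ->
       pairing `]a, b[ dpsi phi = 0].

Definition is_uhat a b (Sv Sp : set R) r (q u0 uhat : R -> R) : Prop :=
  Lp `]a, b[ r uhat /\
  forall psi dpsi, W10 a b Sp (conj_exp r) psi dpsi ->
    pairing `]a, b[ dpsi uhat =
      - (\int[mu]_(x in `]a, b[) (q x * psi x)) +
      \sum_(x \in Sv) u0 x * psi x.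

(* The oriented integral from 1 to t is minus the integral over [t, 1] when
   t <= 1. *)
Definition Phi1 (phi1 : R -> R) (t : R) : R :=
  2^-1 * - \int[mu]_(x in `[t, 1]) phi1 x.

Definition Phi2 (phi2 : R -> R) (t : R) : R :=
  2^-1 * \int[mu]_(x in `[1, t]) phi2 x.

Definition Psi (phi1 phi2 : R -> R) (t : R) : R :=
  if t <= 1 then Phi1 phi1 t else Phi2 phi2 t.

Definition dissipation a b (phi1 phi2 uhat : R -> R) v : R :=
  \int[mu]_(x in `]a, b[) Psi phi1 phi2 ((v x + uhat x) ^+ 2).

Definition energy a b (phi1 phi2 f0 uhat : R -> R) v : R :=
  dissipation a b phi1 phi2 uhat v
  - pairing `]a, b[ f0 (fun x => v x + uhat x).

(* The set of strong local minimizers of F on X: eta does not depend on the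
   direction phi. *)
Definition local_minimizers (X : set (R -> R)) (F : (R -> R) -> R) :
    set (R -> R) :=
  [set v | X v /\ exists2 eta : R, 0 < eta &
     forall phi, X phi -> forall delta, 0 <= delta < eta ->
       F v <= F (fun x => v x + delta * phi x)].

End Defs.

(* Main.v *)
Require Import Defs.
From mathcomp Require Import all_boot all_order all_algebra.
From mathcomp Require Import all_classical all_reals all_analysis.
From mathcomp Require Import measurable_realfun ring lra.
Import Order.TTheory GRing.Theory Num.Theory.
Import numFieldNormedType.Exports.
Set Implicit Arguments.
Unset Strict Implicit.
Unset Printing Implicit Defensive.
Local Open Scope classical_set_scope.
Local Open Scope ring_scope.

(* V contains only functions that are constant almost everywhere: testing phi in
   V against the hat functions min(x, t) + k x + l, whose weak derivative is an
   indicator plus a constant, shows that phi minus its mean has zero primitive.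
   If some endpoint lies outside Sp, the function x + l is also admissible, so
   that the mean of phi vanishes, V = 0, and uniqueness is immediate.
   For existence, V is either 0 or the space of all constants (no characterization
   of which case occurs is needed), and on constants the energy is a function of
   one real variable that is continuous by dominated convergence and coercive
   because Psi(y^2) grows at least quadratically while the load is linear. *)

(** * Integrability on a bounded interval *)

Lemma Lp_measurable (R : realType) (D : set (measurableTypeR R)) (p : R)
    (f : R -> R) :
  measurable D -> Lp D p f -> measurable_fun D f.
Proof.
move=> mD /sub_Lfun_mfun; rewrite inE /= => mf.
exact/(measurable_restrictT _ mD).
Qed.

Lemma Lp_powR_integrable (R : realType) (D : set (measurableTypeR R)) (p : R)
    (f : R -> R) :
  measurable D -> 1 <= p -> Lp D p f ->
  lebesgue_measure.-integrable D (fun x => (`|f x| `^ p)%:E).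
Proof.
move=> mD p1 /(Lfun_integrable p1) intf; apply/(integrable_mkcond _ mD).
apply: eq_integrable intf => // x _.
rewrite /patch; case: ifPn => // _.
by rewrite normr0 powR0// gt_eqF// (lt_le_trans ltr01).
Qed.

Lemma integrable_powR_Lp (R : realType) (D : set (measurableTypeR R)) (p : R)
    (f : R -> R) :
  measurable D -> 1 <= p -> measurable_fun D f ->
  lebesgue_measure.-integrable D (fun x => (`|f x| `^ p)%:E) -> Lp D p f.
Proof.
move=> mD p1 mf intf; rewrite /Lp /= inE; apply/andP; split; rewrite inE /=.
  exact/(measurable_restrictT _ mD).
rewrite /finite_norm unlock poweR_lty//.
move: intf => /(integrable_mkcond _ mD)/integrableP[_]; apply: le_lt_trans.
rewrite le_eqVlt; apply/orP; left; apply/eqP/eq_integral => x _ /=.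
rewrite /patch; case: ifPn => _.
  by rewrite gee0_abs// lee_fin powR_ge0.
by rewrite [RHS]abse0 normr0 powR0// gt_eqF// (lt_le_trans ltr01).
Qed.

Lemma le1_powR (R : realType) (p x : R) : 1 <= p -> 0 <= x -> x <= 1 + x `^ p.
Proof.
move=> p1 x0; have [x1|x1] := leP x 1.
  by rewrite (le_trans x1)// lerDl powR_ge0.
rewrite (@le_trans _ _ (x `^ p))// ?lerDr//.
by rewrite -[leLHS]powRr1// ler_powR// ltW.
Qed.

Section bounded_interval.
Context {R : realType} (a b : R).
Local Notation mu := (@lebesgue_measure R).
Local Notation D := (`]a, b[%classic : set (measurableTypeR R)).

Lemma measurable_oo : measurable D. Proof. exact: measurable_itv. Qed.

Lemma mu_oo_lty : (mu D < +oo)%E.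
Proof. by rewrite lebesgue_measure_itv/=; case: ifP => // _; rewrite -EFinB ltry. Qed.

Local Hint Resolve measurable_oo mu_oo_lty : core.

Lemma integrable_cst_oo (k : R) : mu.-integrable D (EFin \o cst k).
Proof.
apply/integrableP; split; first exact/measurable_EFinP/measurable_cst.
by under eq_integral do rewrite /=; rewrite integral_cst// lte_mul_pinfty.
Qed.

(** On a set of finite measure, [1 + |f|^p] is an integrable majorant of [|f|]. *)
Lemma Lp_integrable (p : R) (f : R -> R) :
  1 <= p -> Lp D p f -> mu.-integrable D (EFin \o f).
Proof.
move=> p1 fp; apply: (@le_integrable _ _ _ mu D measurable_oo _
    (fun x => 1%:E + (`|f x| `^ p)%:E)%E).
- by apply/measurable_EFinP; exact: Lp_measurable fp.
- move=> x _ /=; rewrite lee_fin [leRHS]ger0_norm ?le1_powR//.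
- apply: integrableD => //; first exact: (integrable_cst_oo 1).
  exact: Lp_powR_integrable.
Qed.

Lemma bounded_Lp (p k : R) (f : R -> R) :
  1 <= p -> measurable_fun D f -> (forall x, D x -> `|f x| <= k) -> Lp D p f.
Proof.
move=> p1 mf fk; apply: integrable_powR_Lp => //.
apply: (@le_integrable _ _ _ mu D measurable_oo _ (EFin \o cst (k `^ p))).
- apply/measurable_EFinP.
  apply: (measurableT_comp (measurable_powR _)) => //.
  exact: measurableT_comp.
- move=> x Dx /=; rewrite lee_fin !(ger0_norm (powR_ge0 _ _)).
  have p0 : 0 <= p by exact: le_trans p1.
  have k0 : 0 <= k by exact: le_trans (fk _ Dx).
  by rewrite ge0_ler_powR// ?nnegrE ?fk.
- exact: (integrable_cst_oo (k `^ p)).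
Qed.

(** Hoelder's inequality for the zero extensions, whose product is the zero extension of the
    product. *)
Lemma Lp_mul_integrable (p q : R) (f g : R -> R) :
  0 < p -> 0 < q -> p^-1 + q^-1 = 1 -> Lp D p f -> Lp D q g ->
  mu.-integrable D (EFin \o (fun x => f x * g x)).
Proof.
move=> p0 q0 pq fp gq.
have mf := Lp_measurable measurable_oo fp.
have mg := Lp_measurable measurable_oo gq.
have fg := hoelder mu ((measurable_restrictT _ measurable_oo).1 mf)
  ((measurable_restrictT _ measurable_oo).1 mg) p0 q0 pq.
apply/(integrable_mkcond _ measurable_oo)/integrableP; split.
  apply/(measurable_restrictT _ measurable_oo)/measurable_EFinP.
  exact: measurable_funM.
move/sub_Lfun_finLfun: fp; rewrite inE /finite_norm /= => fp.
move/sub_Lfun_finLfun: gq; rewrite inE /finite_norm /= => gq.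
apply: (@le_lt_trans _ _ ('N[mu]_p%:E[EFin \o (f \_ D)] *
                          'N[mu]_q%:E[EFin \o (g \_ D)])%E); last first.
  by rewrite lte_mul_pinfty ?Lnorm_ge0// ge0_fin_numE ?Lnorm_ge0.
apply: le_trans fg; rewrite Lnorm1 le_eqVlt; apply/orP; left; apply/eqP.
apply: eq_integral => x _ /=; rewrite /patch; case: ifPn => //= _.
by rewrite mulr0.
Qed.

End bounded_interval.

(** * Vanishing primitives *)

Section primitive.
Context {R : realType} (a b : R).
Local Notation mu := (@lebesgue_measure R).
Local Notation D := (`]a, b[%classic : set (measurableTypeR R)).

(** Extended by zero, [f] has a primitive from minus infinity that vanishes on the whole line. By
    Lebesgue differentiation, the derivative of this primitive, which is zero, equals [f] almost
    everywhere. *)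
Lemma primitive_eq0_ae (f : R -> R) : a <= b -> mu.-integrable D (EFin \o f) ->
  (forall t, a <= t <= b -> \int[mu]_(x in `]a, t[) f x = 0) ->
  ae_eq mu D f (cst 0).
Proof.
move=> ab intf f0.
have intfD : mu.-integrable [set: R] (EFin \o (f \_ D)).
  by rewrite -restrict_EFin; apply/(integrable_mkcond _ (measurable_oo a b)).
have F0 t : \int[mu]_(x in `]-oo, t]) (f \_ D) x = 0.
  rewrite -Rintegral_mkcondr.
  have [ta|at_] := leP t a.
    rewrite [X in Rintegral _ X _](_ : _ = set0) ?Rintegral_set0//.
    rewrite -subset0 => x [] /=; rewrite !in_itv/= => xt /andP[ax _].
    by have := lt_le_trans ax (le_trans xt ta); rewrite ltxx.
  have [tb|bt] := ltP t b; last first.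
    rewrite (_ : _ `&` _ = `]a, b[%classic).
      by apply: f0; rewrite ab lexx.
    rewrite setIidr// => x /=; rewrite !in_itv/= => /andP[_ /ltW xb].
    exact: le_trans bt.
  rewrite (_ : _ `&` _ = `]a, t]%classic).
    rewrite -Rintegral_itv_bndo_bndc ?f0 ?(ltW at_) ?(ltW tb)//.
    apply: integrableS intf => //.
    by apply: subset_itvl; rewrite bnd_simp ltW.
  apply/seteqP; split=> x /=; rewrite !in_itv/=.
    by move=> [-> /andP[->]].
  by move=> /andP[-> xt]; rewrite xt; split => //; exact: le_lt_trans tb.
have intfy y : mu.-integrable `]-oo, y] (EFin \o (f \_ D)).
  exact: integrableS intfD.
have := @FTC1Ny _ (f \_ D) intfy.
move=> /(_ _)[|]; first exact: integrable_locally.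
move=> N [mN N0 sN]; exists N; split=> // x /= nx; apply: sN => /= -[].
move=> _ fx; apply: nx => Dx; move: fx.
rewrite (_ : (fun _ => _) = cst 0); last by apply/funext => t; exact: F0.
by rewrite derive1_cst patchE mem_set.
Qed.

End primitive.

(** * Hat functions as elements of the Sobolev space *)

Section test_functions.
Context {R : realType} (a b : R).
Local Notation mu := (@lebesgue_measure R).
Local Notation D := (`]a, b[%classic : set (measurableTypeR R)).

Lemma continuous_itv_integrable (f : R -> R) (u w : R) (i j : bool) :
  continuous f -> mu.-integrable [set` Interval (BSide i u) (BSide j w)] (EFin \o f).
Proof.
move=> cf; apply: (@integrableS _ _ _ mu `[u, w]) => //.
  by apply: subset_itv; rewrite bnd_simp; case: i j => -[].
apply: continuous_compact_integrable; first exact: segment_compact.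
exact: continuous_subspaceT.
Qed.

Lemma Rintegral_oo_split (f : R -> R) (t : R) : a <= t <= b ->
  mu.-integrable D (EFin \o f) ->
  \int[mu]_(x in D) f x = \int[mu]_(x in `]a, t]) f x + \int[mu]_(x in `]t, b[) f x.
Proof.
move=> /andP[a_t]; rewrite le_eqVlt => /predU1P[->|t_b] intf.
  by rewrite (@set_itv_ge _ _ (BRight b)) ?bnd_simp// Rintegral_set0 addr0
    Rintegral_itv_bndo_bndc.
by apply/eqP; rewrite addrC -subr_eq (Rintegral_itvB intf) ?bnd_simp.
Qed.

Lemma test_function_boundary (chi : R -> R) :
  test_function D chi -> chi a = 0 /\ chi b = 0.
Proof.
move=> [_ _ supp]; split; apply/eqP/negPn/negP => chi0;
  have /= := supp _ (@subset_closure _ [set x | chi x != 0] _ chi0);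
  by rewrite in_itv/= ltxx ?andbF.
Qed.

Lemma smooth_continuous (chi : R -> R) :
  (forall n x, derivable (derive1n n chi) x 1) ->
  continuous chi /\ continuous (derive1 chi).
Proof.
move=> dchi; split=> x; apply: differentiable_continuous; apply/derivable1_diffP.
- exact: (dchi 0%N).
- exact: (dchi 1%N).
Qed.

Lemma continuous_affine (k l : R) : continuous (fun x : R => k * x + l).
Proof. by move=> x; apply: cvgD; [apply: cvgMr|exact: cvg_cst]. Qed.

Lemma affine_by_parts (chi : R -> R) (k l u w : R) : u <= w ->
  (forall n x, derivable (derive1n n chi) x 1) ->
  \int[mu]_(x in `[u, w]) ((k * x + l) * derive1 chi x) =
  (k * w + l) * chi w - (k * u + l) * chi u - k * \int[mu]_(x in `[u, w]) chi x.
Proof.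
(* Integration by parts is done for [u < w]; a single point is treated apart so that the cut [t] of
   a hat function may be an endpoint. *)
rewrite le_eqVlt => /predU1P[->|uw] dchi.
  by rewrite set_itv1 !Rintegral_set1 subrr mulr0 subr0.
have [cchi cdchi] := smooth_continuous dchi.
rewrite -RintegralZl//; last exact: continuous_itv_integrable.
apply: (@Rintegration_by_parts _ (fun x => k * x + l) chi (fun=> k)) => //.
- by apply: continuous_subspaceT => x; exact: cvg_cst.
- split.
  + by move=> x _.
  + by apply: cvg_at_right_filter; exact: continuous_affine.
  + by apply: cvg_at_left_filter; exact: continuous_affine.
- move=> x _; rewrite derive1E deriveD// derive_cst addr0 deriveM// derive_cst.
  by rewrite derive_id scaler0 addr0 /GRing.scale/= mulr1.
- exact: continuous_subspaceT.
- split; [by move=> x _; exact: (dchi 0%N)|..].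
  + by apply: cvg_at_right_filter; exact: cchi.
  + by apply: cvg_at_left_filter; exact: cchi.
Qed.

Lemma affine_by_parts_oc (chi : R -> R) (k l u w : R) : u <= w ->
  (forall n x, derivable (derive1n n chi) x 1) ->
  \int[mu]_(x in `]u, w]) ((k * x + l) * derive1 chi x) =
  (k * w + l) * chi w - (k * u + l) * chi u - k * \int[mu]_(x in `]u, w]) chi x.
Proof.
move=> uw dchi; have [cchi cdchi] := smooth_continuous dchi.
rewrite !Rintegral_itv_obnd_cbnd ?affine_by_parts//;
  apply: continuous_itv_integrable => // x.
by apply: cvgM; [exact: continuous_affine|exact: cdchi].
Qed.

Lemma affine_by_parts_oo (chi : R -> R) (k l u w : R) : u <= w ->
  (forall n x, derivable (derive1n n chi) x 1) ->
  \int[mu]_(x in `]u, w[) ((k * x + l) * derive1 chi x) =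
  (k * w + l) * chi w - (k * u + l) * chi u - k * \int[mu]_(x in `]u, w[) chi x.
Proof.
move=> uw dchi; have [cchi cdchi] := smooth_continuous dchi.
rewrite !Rintegral_itv_bndo_bndc ?affine_by_parts_oc//;
  apply: continuous_itv_integrable => // x.
by apply: cvgM; [exact: continuous_affine|exact: cdchi].
Qed.

Lemma continuous_hat (t k l : R) : continuous (fun x => Num.min x t + (k * x + l)).
Proof.
move=> x; apply: cvgD; last exact: continuous_affine.
by apply: continuous_min => //; exact: cvg_cst.
Qed.

(** The function is affine on either side of [t], so each side is integrated by parts. The boundary
    terms at [t] cancel because both pieces take the value [t + k * t + l] there, and those at [a]
    and [b] vanish with [chi]. *)
Lemma weak_derivative_hat (t k l : R) : a <= t <= b ->
  weak_derivative D (fun x => Num.min x t + (k * x + l))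
                    (fun x => \1_`]-oo, t] x + k).
Proof.
move=> atb chi chiD; have [chia chib] := test_function_boundary chiD.
have [dchi _ _] := chiD; have [cchi cdchi] := smooth_continuous dchi.
have /andP[a_t t_b] := atb.
rewrite (@Rintegral_oo_split _ t)//; last first.
  apply: continuous_itv_integrable => x.
  by apply: cvgM; [exact: continuous_hat|exact: cdchi].
rewrite (@Rintegral_oo_split (fun x => _ * chi x) t)//; last first.
  (* The indicator jumps at [t], so integrability comes from a continuous majorant. *)
  apply: (@le_integrable _ _ _ mu D _ _ (EFin \o (fun x => (1 + `|k|) * chi x))).
  - exact: measurable_oo.
  - apply/measurable_EFinP/measurable_funM.
      apply: measurable_funD => //.
    apply: measurable_funTS; exact: continuous_measurable_fun.
  - move=> x _ /=; rewrite lee_fin !normrM ler_wpM2r// (le_trans (ler_normD _ _))//.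
    rewrite (@ger0_norm _ (1 + _)) ?addr_ge0// lerD2r indicE.
    by case: (_ \in _); rewrite ?normr1 ?normr0.
  - apply: continuous_itv_integrable => x.
    by apply: cvgM; [exact: cvg_cst|exact: cchi].
have -> : \int[mu]_(x in `]a, t]) ((Num.min x t + (k * x + l)) * derive1 chi x) =
    \int[mu]_(x in `]a, t]) (((1 + k) * x + l) * derive1 chi x).
  apply: eq_Rintegral => x; rewrite inE/= in_itv/= => /andP[_ xt].
  by rewrite min_l//; congr (_ * _); ring.
have -> : \int[mu]_(x in `]t, b[) ((Num.min x t + (k * x + l)) * derive1 chi x) =
    \int[mu]_(x in `]t, b[) ((k * x + (t + l)) * derive1 chi x).
  apply: eq_Rintegral => x; rewrite inE/= in_itv/= => /andP[/ltW tx _].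
  by rewrite min_r//; congr (_ * _); ring.
have -> : \int[mu]_(x in `]a, t]) ((\1_`]-oo, t] x + k) * chi x) =
    \int[mu]_(x in `]a, t]) ((1 + k) * chi x).
  apply: eq_Rintegral => x; rewrite inE/= in_itv/= => /andP[_ xt].
  by rewrite indicE mem_set//= in_itv.
have -> : \int[mu]_(x in `]t, b[) ((\1_`]-oo, t] x + k) * chi x) =
    \int[mu]_(x in `]t, b[) (k * chi x).
  apply: eq_Rintegral => x; rewrite inE/= in_itv/= => /andP[tx _].
  by rewrite indicE memNset ?add0r//= in_itv/= leNgt tx.
rewrite affine_by_parts_oc// affine_by_parts_oo// chia chib.
rewrite !RintegralZl//; [ring|exact: continuous_itv_integrable..].
Qed.

Lemma W1_hat (s t k l : R) : a <= t <= b -> 1 <= s ->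
  W1 a b s (fun x => Num.min x t + (k * x + l)) (fun x => \1_`]-oo, t] x + k).
Proof.
move=> atb s1; split.
- by apply: continuous_subspaceT; exact: continuous_hat.
- have ab : a <= b by case/andP: atb => /le_trans; apply.
  (* The maximum of the absolute value on the closed interval is the bound that gives membership in
     [Lp]. *)
  have [|x0 _ max0] := @EVT_max _ (fun x => `|Num.min x t + (k * x + l)|) _ _ ab.
    apply: continuous_subspaceT => x.
    exact: (cvg_norm (@continuous_hat t k l x)).
  apply: (bounded_Lp s1 (k := `|Num.min x0 t + (k * x0 + l)|)); last first.
    by move=> x Dx; apply: max0; exact: subset_itv_oo_cc.
  apply: measurable_funTS.
  by apply: continuous_measurable_fun; exact: continuous_hat.
- apply: (@bounded_Lp _ _ _ _ (1 + `|k|)) => //.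
    by apply: measurable_funD.
  move=> x _; rewrite (le_trans (ler_normD _ _))// lerD2r indicE.
  by case: (_ \in _); rewrite ?normr1 ?normr0.
- exact: weak_derivative_hat.
Qed.

End test_functions.

(** * Elements of V are constant almost everywhere *)

Lemma Rintegral_oo_cst (R : realType) (a b k : R) : a <= b ->
  \int[lebesgue_measure]_(x in `]a, b[) k = k * (b - a).
Proof.
move=> ab; rewrite Rintegral_cst//; congr (_ * _).
have : lebesgue_measure (`]a, b[%classic : set R) = (b - a)%:E.
  rewrite lebesgue_measure_itv/= lte_fin.
  by case: ltgtP ab => // -> _; rewrite subrr.
by move/(congr1 fine).
Qed.

Section space_V.
Context {R : realType} (a b : R).
Local Notation mu := (@lebesgue_measure R).
Local Notation D := (`]a, b[%classic : set (measurableTypeR R)).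

Lemma Vol0_eq0 (A : set R) : Vol0 A = 0%E -> A = set0.
Proof.
rewrite /Vol0 /counting; case: ifPn => // /asboolP finA.
by move/eqP; rewrite eqe pnatr_eq0 finmap.cardfs_eq0 => /eqP/(fset_set_set0 finA).
Qed.

Lemma Vol0_gt0 (A : set R) : (0 < Vol0 A)%E -> A !=set0.
Proof.
move=> A0; apply/set0P/eqP => A_; move: A0.
by rewrite A_ /Vol0 /counting asboolT// fset_set0 ltxx.
Qed.

(** The constant [l] is free to meet one normalization: a zero at an endpoint in [Sp], or mean zero
    if [Sp] is empty. When both endpoints lie in [Sp], a single shift works only if the end values
    [a + k * a] and [t + k * b] agree, which is the last hypothesis. *)
Lemma W10_hat (Sp : set R) (s t k : R) : a < b -> Sp `<=` [set a; b] ->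
  1 <= s -> a <= t <= b -> (Sp a -> Sp b -> a + k * a = t + k * b) ->
  exists l, W10 a b Sp s (fun x => Num.min x t + (k * x + l))
                         (fun x => \1_`]-oo, t] x + k).
Proof.
move=> ab Spab s1 atb Spk; have /andP[a_t t_b] := atb.
have Sp0 : Sp !=set0 -> Vol0 Sp <> 0%E.
  by move=> /set0P/eqP + /Vol0_eq0.
have [Spa|nSpa] := pselect (Sp a).
  exists (- (a + k * a)); split; first exact: W1_hat.
  - by move/Sp0: (ex_intro _ a Spa).
  - move=> _ x Spx; have [->|xb] := Spab _ Spx; first by rewrite min_l//; ring.
    by rewrite xb min_r// Spk -?xb//; ring.
have [Spb|nSpb] := pselect (Sp b).
  exists (- (t + k * b)); split; first exact: W1_hat.
  - by move/Sp0: (ex_intro _ b Spb).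
  - move=> _ x Spx; have [xa|->] := Spab _ Spx; first by rewrite xa in Spx.
    by rewrite min_r//; ring.
(* Here [Sp] contains neither endpoint, hence is empty, and subtracting the mean gives the required
   zero integral. *)
pose m := \int[mu]_(x in D) (Num.min x t + (k * x + 0)) / (b - a).
exists (- m); split; first exact: W1_hat.
- move=> _; under eq_Rintegral do rewrite -[X in k * _ + X]add0r !addrA.
  rewrite RintegralD//; last exact: integrable_cst_oo.
    rewrite Rintegral_oo_cst ?(ltW ab)// mulNr /m divfK ?subr_eq0 ?gt_eqF//.
    by under eq_Rintegral do rewrite -addrA; rewrite subrr.
  apply: continuous_itv_integrable => x; under eq_fun do rewrite -addrA.
  exact: continuous_hat.
- by move=> _ x Spx; case: (Spab _ Spx) => /= xE; rewrite xE in Spx.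
Qed.

Lemma conj_exp_ge1 (r : R) : 2 <= r -> 1 <= conj_exp r.
Proof. by move=> r2; rewrite /conj_exp ler_pdivlMr; lra. Qed.

Lemma pairing_hat (t k : R) (phi : R -> R) : a <= t <= b ->
  mu.-integrable D (EFin \o phi) ->
  pairing D (fun x => \1_`]-oo, t] x + k) phi =
  \int[mu]_(x in `]a, t[) phi x + k * \int[mu]_(x in D) phi x.
Proof.
move=> /andP[a_t t_b] intphi.
have ind : mu.-integrable D (EFin \o (fun x => \1_`]-oo, t] x * phi x)).
  apply: (le_integrable (measurable_oo a b) _ _ intphi).
  - apply/measurable_EFinP/measurable_funM => //.
    by apply/measurable_EFinP; exact: measurable_int intphi.
  - move=> x _ /=; rewrite lee_fin normrM ler_piMl// indicE.
    by case: (_ \in _); rewrite ?normr1 ?normr0.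
rewrite /pairing; under eq_Rintegral do rewrite mulrDl.
rewrite RintegralD//; last first.
  exact: (integrableZl (measurable_oo a b) k intphi).
rewrite RintegralZl//; congr (_ + _).
rewrite (@Rintegral_oo_split _ a b _ t)//; last by rewrite a_t.
rewrite [X in _ + X](_ : _ = 0) ?addr0; last first.
  rewrite (_ : 0 = \int[mu]_(x in `]t, b[) 0); last first.
    by rewrite Rintegral_cst// mul0r.
  apply: eq_Rintegral => x; rewrite inE/= in_itv/= => /andP[tx _].
  by rewrite indicE memNset ?mul0r//= in_itv/= leNgt tx.
rewrite Rintegral_itv_bndo_bndc; last first.
  by apply: integrableS intphi => //; apply: subset_itvl; rewrite bnd_simp.
apply: eq_Rintegral => x; rewrite inE/= in_itv/= => /andP[_ xt].
by rewrite indicE mem_set ?mul1r//= in_itv.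
Qed.

Lemma V_integrable (Sp : set R) (r : R) (phi : R -> R) : 2 <= r ->
  V a b Sp r phi -> mu.-integrable D (EFin \o phi).
Proof. by move=> r2 [+ _]; apply: Lp_integrable; lra. Qed.

(* The weak derivative of a hat function is the indicator of an interval up to
   a constant, so phi minus its mean has vanishing primitive. *)
Lemma V_ae_mean (Sp : set R) (r : R) (phi : R -> R) : a < b ->
  Sp `<=` [set a; b] -> 2 <= r -> V a b Sp r phi ->
  ae_eq mu D phi (cst (\int[mu]_(x in D) phi x / (b - a))).
Proof.
move=> ab Spab r2 Vphi; have intphi := V_integrable r2 Vphi.
set m := _ / _.
have ba0 : b - a != 0 by rewrite subr_eq0 gt_eqF.
have intm : mu.-integrable D (EFin \o cst m) by exact: integrable_cst_oo.
have : ae_eq mu D (fun x => phi x - m) (cst 0).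
  apply: primitive_eq0_ae; first exact: ltW.
    exact: (integrableB _ intphi intm).
  move=> t atb; have /andP[a_t t_b] := atb.
  have sub : `]a, t[ `<=` D by apply: subset_itvl; rewrite bnd_simp.
  rewrite RintegralB//; [|exact: (integrableS (measurable_oo a b) _ sub intphi)
                    |exact: (integrableS (measurable_oo a b) _ sub intm)].
  (* This slope solves [a + k * a = t + k * b], so the hat function is admissible whatever [Sp] is.
     Testing with it shows that the integral of [phi] up to [t] is [m * (t - a)]. *)
  have [|l W] := @W10_hat Sp (conj_exp r) t (- ((t - a) / (b - a))) ab Spab
    (conj_exp_ge1 r2) atb.
    by move=> _ _; field.
  have := Vphi.2 _ _ W; rewrite pairing_hat// => /eqP.
  rewrite addr_eq0 => /eqP ->; apply/eqP; rewrite subr_eq0 /m; apply/eqP.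
  by rewrite Rintegral_oo_cst//; field.
apply: filterS => x + Dx => /(_ Dx)/eqP; rewrite subr_eq0 => /eqP.
by [].
Qed.

Lemma V_mean_eq0 (Sp : set R) (r : R) (phi : R -> R) : a < b ->
  Sp `<=` [set a; b] -> ~ (Sp a /\ Sp b) -> 2 <= r -> V a b Sp r phi ->
  \int[mu]_(x in D) phi x = 0.
Proof.
move=> ab Spab nSp r2 Vphi.
have bab : a <= b <= b by rewrite lexx ltW.
(* For [t = b] and [k = 0] the hat function is [x + l] on the interval, with derivative 1, so the
   pairing is the integral of [phi]. *)
have [|l W] := @W10_hat Sp (conj_exp r) b 0 ab Spab (conj_exp_ge1 r2) bab.
  by move=> Spa Spb; case: nSp.
have := Vphi.2 _ _ W; rewrite pairing_hat//; last exact: V_integrable Vphi.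
by rewrite mul0r addr0.
Qed.

End space_V.

(** * The dissipation density *)

Lemma Rintegral_cc_cst (R : realType) (a b k : R) : a <= b ->
  \int[lebesgue_measure]_(x in `[a, b]) k = k * (b - a).
Proof.
move=> ab; rewrite Rintegral_cst//; congr (_ * _).
have : lebesgue_measure (`[a, b]%classic : set R) = (b - a)%:E.
  rewrite lebesgue_measure_itv/= lte_fin.
  by case: ltgtP ab => // -> _; rewrite subrr.
by move/(congr1 fine).
Qed.

Lemma integrable_cst_cc (R : realType) (a b k : R) :
  (@lebesgue_measure R).-integrable `[a, b] (EFin \o cst k).
Proof. by apply: continuous_itv_integrable => x; exact: cvg_cst. Qed.

(** The primitive is continuous relative to [[u, w]]; restricting to the open interval makes this
    ordinary continuity at the interior point [t]. *)
Lemma primitive_continuous (R : realType) (f : R -> R) (u t w : R) :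
  u < t < w -> (@lebesgue_measure R).-integrable `[u, w] (EFin \o f) ->
  {for t, continuous (fun x => \int[lebesgue_measure]_(y in `[u, x]) f y)}.
Proof.
move=> utw intf; have uw : u <= w by case/andP: utw => uv vw; exact/ltW/(lt_trans uv).
have := parameterized_integral_continuous uw intf.
move=> /(continuous_subspaceW (@subset_itv_oo_cc _ _ u w)).
rewrite continuous_open_subspace; last exact: interval_open.
by apply; rewrite inE/= in_itv.
Qed.

Section constitutive.
Context {R : realType}.
Local Notation mu := (@lebesgue_measure R).

Lemma phi1_integrable (phi1 : R -> R) (u : R) :
  {within `[0, 1], continuous phi1} ->
  0 <= u -> mu.-integrable `[u, 1] (EFin \o phi1).
Proof.
move=> phi1_cont u0; apply: (@integrableS _ _ _ mu `[0, 1]) => //.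
  by apply: subset_itvr; rewrite bnd_simp.
by apply: continuous_compact_integrable => //; exact: segment_compact.
Qed.

Lemma phi2_integrable (phi2 : R -> R) (t : R) :
  {within `[1, +oo[, continuous phi2} ->
  mu.-integrable `[1, t] (EFin \o phi2).
Proof.
move=> phi2_cont.
apply: continuous_compact_integrable; first exact: segment_compact.
by apply: continuous_subspaceW phi2_cont => x /=; rewrite !in_itv/= => /andP[->].
Qed.

(** Each of [Phi1] and [Phi2] integrates over an empty interval on the other's side of 1. Writing
    [Psi] as a sum spares a gluing argument at 1 in the proof of continuity. *)
Lemma PsiE (phi1 phi2 : R -> R) (t : R) : Psi phi1 phi2 t = Phi1 phi1 t + Phi2 phi2 t.
Proof.
rewrite /Psi /Phi1 /Phi2; have [t1|t1|->] := ltgtP t 1.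
- by rewrite (@set_itv_ge _ _ (BLeft 1)) ?Rintegral_set0 ?mulr0 ?addr0// bnd_simp -ltNge.
- by rewrite (@set_itv_ge _ _ (BLeft t)) ?Rintegral_set0 ?oppr0 ?mulr0 ?add0r// bnd_simp -ltNge.
- by rewrite set_itv1 !Rintegral_set1 oppr0 mulr0 addr0.
Qed.

(* The primitives start at -1 so that the values y^2, including 0, are interior
   points of the domain on which they are continuous. *)
Lemma Phi1_primitive (phi1 : R -> R) (t : R) :
  {within `[0, 1], continuous phi1} ->
  0 <= t -> Phi1 phi1 t =
  2^-1 * (\int[mu]_(x in `[(-1), t]) (phi1 \_ `[0, 1]) x -
          \int[mu]_(x in `[0, 1]) phi1 x).
Proof.
move=> phi1_cont t0; rewrite /Phi1 -Rintegral_mkcondr; congr (_ * _).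
(* For [t > 1] the interval in [Phi1] is empty, and the two integrals on the right coincide. *)
have [t1|t1] := leP t 1; last first.
  rewrite [in LHS](@set_itv_ge _ _ (BLeft t)) ?bnd_simp -?ltNge//.
  rewrite Rintegral_set0 oppr0 (_ : _ `&` _ = `[0, 1]%classic) ?subrr//.
  rewrite setIidr// => x /=; rewrite !in_itv/= => /andP[x0 x1].
  by apply/andP; split; lra.
rewrite (_ : _ `&` _ = `[0, t]%classic); last first.
  apply/seteqP; split => x /=; rewrite !in_itv/=.
    by move=> [/andP[_ ->] /andP[->]].
  by move=> /andP[x0 xt]; split; apply/andP; split; lra.
have int01 := phi1_integrable phi1_cont (lexx 0).
rewrite -opprB; congr (- _).
rewrite (Rintegral_itvB int01) ?bnd_simp// Rintegral_itv_obnd_cbnd//.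
by apply: integrableS int01 => //; apply: subset_itvr; rewrite bnd_simp.
Qed.

Lemma Phi2_primitive (phi2 : R -> R) (t : R) : Phi2 phi2 t =
  2^-1 * \int[mu]_(x in `[(-1), t]) (phi2 \_ `[1, +oo[) x.
Proof.
rewrite /Phi2 -Rintegral_mkcondr; congr (_ * Rintegral _ _ _).
apply/seteqP; split => x /=; rewrite !in_itv/= ?andbT.
  by move=> /andP[x1 ->]; split => //; rewrite andbT; lra.
by move=> [/andP[_ ->] ->].
Qed.

Lemma Psi_sqr_continuous (phi1 phi2 : R -> R) :
  {within `[0, 1], continuous phi1} ->
  {within `[1, +oo[, continuous phi2} ->
  continuous (fun y : R => Psi phi1 phi2 (y ^+ 2)).
Proof.
move=> phi1_cont phi2_cont.
have -> : (fun y : R => Psi phi1 phi2 (y ^+ 2)) = (fun y : R =>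
    2^-1 * (\int[mu]_(x in `[(-1), y ^+ 2]) (phi1 \_ `[0, 1]) x -
            \int[mu]_(x in `[0, 1]) phi1 x) +
    2^-1 * \int[mu]_(x in `[(-1), y ^+ 2]) (phi2 \_ `[1, +oo[) x).
  by apply/funext => y; rewrite PsiE Phi1_primitive ?sqr_ge0// Phi2_primitive.
move=> y; have y2 : -1 < y ^+ 2 < y ^+ 2 + 1 by have := sqr_ge0 y; lra.
have csqr : {for y, continuous (fun z : R => z ^+ 2)} by exact: exprn_continuous.
have int1 : mu.-integrable `[(-1), y ^+ 2 + 1] (EFin \o (phi1 \_ `[0, 1])).
  rewrite -restrict_EFin; apply/integrable_restrict => //.
  apply: (@integrableS _ _ _ mu `[0, 1]) => //; first exact: measurableI.
  exact: phi1_integrable.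
have int2 : mu.-integrable `[(-1), y ^+ 2 + 1] (EFin \o (phi2 \_ `[1, +oo[)).
  rewrite -restrict_EFin; apply/integrable_restrict => //.
  apply: (@integrableS _ _ _ mu `[1, y ^+ 2 + 1]) => //; first exact: measurableI.
    by move=> x [/=]; rewrite !in_itv/= andbT => /andP[_ ->] ->.
  exact: phi2_integrable.
apply: cvgD; apply: cvgMr.
- apply: cvgB; last exact: cvg_cst.
  exact: (continuous_comp csqr (primitive_continuous y2 int1)).
- exact: (continuous_comp csqr (primitive_continuous y2 int2)).
Qed.

(** By monotonicity the integrand lies between 0 and [phi1 1], and the interval has length at most
    1. *)
Lemma Phi1_bounds (phi1 : R -> R) (t : R) :
  {within `[0, 1], continuous phi1} ->
  (forall t : R, 0 <= t -> 0 <= phi1 t) ->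
  {in `[0, 1] &, {homo phi1 : x y / x <= y}} ->
  0 <= t <= 1 -> - (phi1 1 / 2) <= Phi1 phi1 t <= 0.
Proof.
move=> phi1_cont phi1_ge0 phi1_incr /andP[t0 t1]; rewrite /Phi1.
have I0 : 0 <= \int[mu]_(x in `[t, 1]) phi1 x.
  apply: Rintegral_ge0 => x /=; rewrite in_itv/= => /andP[tx _].
  by apply: phi1_ge0; exact: le_trans tx.
have I1 : \int[mu]_(x in `[t, 1]) phi1 x <= phi1 1.
  apply: (@le_trans _ _ (\int[mu]_(x in `[t, 1]) phi1 1)).
    apply: le_Rintegral => //; [exact: phi1_integrable|exact: integrable_cst_cc|].
    move=> x /=; rewrite in_itv/= => /andP[tx x1].
    by apply: phi1_incr; rewrite ?in_itv/= ?lexx ?ler01 ?x1 ?(le_trans t0 tx).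
  rewrite Rintegral_cc_cst// -[leRHS]mulr1 ler_wpM2l ?phi1_ge0//; lra.
move: (Rintegral _ _ _) I0 I1 => I I0 I1.
by apply/andP; split; lra.
Qed.

(** Since [r >= 2], the power in the growth condition is at least 1 on [[1, t]], so [phi2 >= c]
    there. *)
Lemma Phi2_ge (phi2 : R -> R) (c C r : R) (t : R) :
  2 <= r ->
  0 < c ->
  {within `[1, +oo[, continuous phi2} ->
  (forall t : R, 1 <= t ->
     c * t `^ ((r - 2) / 2) <= phi2 t <= C * (1 + t `^ ((r - 2) / 2))) ->
  1 <= t -> c / 2 * (t - 1) <= Phi2 phi2 t.
Proof.
move=> ge2r c_gt0 phi2_cont phi2_growth t1; rewrite /Phi2.
rewrite [leLHS](_ : _ = 2^-1 * (c * (t - 1))); last by ring.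
rewrite ler_pM2l ?invr_gt0// -Rintegral_cc_cst//.
apply: le_Rintegral => //; [exact: integrable_cst_cc|exact: phi2_integrable|].
move=> x /=; rewrite in_itv/= => /andP[x1 _].
have /andP[+ _] := phi2_growth _ x1; apply: le_trans.
rewrite -[leLHS]mulr1 ler_wpM2l ?(ltW c_gt0)//.
by rewrite -[leLHS](powRr0 x) ler_powR//; lra.
Qed.

Lemma Phi2_le (phi2 : R -> R) (c C r : R) (t : R) :
  2 <= r ->
  0 < C ->
  {within `[1, +oo[, continuous phi2} ->
  {in `[1, +oo[ &, {homo phi2 : x y / x <= y}} ->
  (forall t : R, 1 <= t ->
     c * t `^ ((r - 2) / 2) <= phi2 t <= C * (1 + t `^ ((r - 2) / 2))) ->
  1 <= t -> Phi2 phi2 t <= C * t `^ (r / 2).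
Proof.
move=> ge2r C_gt0 phi2_cont phi2_incr phi2_growth t1; have t0 : 0 < t by lra.
have tr : 1 <= t `^ ((r - 2) / 2).
  by rewrite -[leLHS](powRr0 t) ler_powR//; lra.
(* On [[1, t]] monotonicity gives [phi2 x <= phi2 t], and with [z] the power of [t],
   [1 + z <= 2 * z] because [z >= 1]. The factor 2 cancels the one half in [Phi2]. *)
rewrite /Phi2 (@le_trans _ _ (2^-1 * ((C * (t `^ ((r - 2) / 2) *+ 2)) * (t - 1))))//.
  rewrite ler_pM2l ?invr_gt0// -Rintegral_cc_cst//.
  apply: le_Rintegral => //; [exact: phi2_integrable|exact: integrable_cst_cc|].
  move=> x /=; rewrite in_itv/= => /andP[x1 xt].
  have : phi2 x <= phi2 t by apply: phi2_incr; rewrite ?in_itv/= ?andbT.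
  move=> /le_trans; apply.
  have /andP[_] := phi2_growth _ t1; move=> /le_trans; apply.
  by rewrite ler_pM2l// mulr2n lerD2r.
have -> : r / 2 = (r - 2) / 2 + 1 by field.
rewrite powRD; last by apply/implyP => _; rewrite gt_eqF.
rewrite powRr1 ?(ltW t0)// mulr2n.
set z := t `^ _ in tr *.
have Cz : 0 <= C * z by rewrite mulr_ge0 ?(ltW C_gt0)//; lra.
rewrite [leLHS](_ : _ = C * z * (t - 1)); last by field.
by rewrite mulrA ler_wpM2l//; lra.
Qed.

Lemma sqr_powR_half (r y : R) : (y ^+ 2) `^ (r / 2) = `|y| `^ r.
Proof.
rewrite -real_normK ?num_real// -powR_mulrn// -powRrM; by congr (_ `^ _); field.
Qed.

(** Growth of order [r] makes the density integrable along [L^r] functions and supplies the majorant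
    for dominated convergence. *)
Lemma Psi_sqr_le (phi1 phi2 : R -> R) (c C r : R) (y : R) :
  2 <= r ->
  {within `[0, 1], continuous phi1} ->
  (forall t : R, 0 <= t -> 0 <= phi1 t) ->
  {in `[0, 1] &, {homo phi1 : x y / x <= y}} ->
  {within `[1, +oo[, continuous phi2} ->
  {in `[1, +oo[ &, {homo phi2 : x y / x <= y}} ->
  0 < c ->
  0 < C ->
  (forall t : R, 1 <= t ->
     c * t `^ ((r - 2) / 2) <= phi2 t <= C * (1 + t `^ ((r - 2) / 2))) ->
  `|Psi phi1 phi2 (y ^+ 2)| <= phi1 1 + C * `|y| `^ r.
Proof.
move=> ge2r phi1_cont phi1_ge0 phi1_incr phi2_cont phi2_incr c_gt0 C_gt0 phi2_growth.
have phi11 := phi1_ge0 _ ler01.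
have Cy : 0 <= C * `|y| `^ r by rewrite mulr_ge0 ?powR_ge0// ltW.
rewrite /Psi; case: (leP (y ^+ 2) 1) => y1.
  have := Phi1_bounds (t := y ^+ 2) phi1_cont phi1_ge0 phi1_incr.
  rewrite sqr_ge0 y1 => /(_ isT) /andP[? ?].
  by rewrite ler_norml; apply/andP; split; lra.
rewrite ger0_norm.
  have := Phi2_le ge2r C_gt0 phi2_cont phi2_incr phi2_growth (ltW y1).
  rewrite sqr_powR_half; lra.
apply: le_trans (Phi2_ge ge2r c_gt0 phi2_cont phi2_growth (ltW y1)).
by rewrite mulr_ge0//; lra.
Qed.

(** For [y ^+ 2 <= 1] the quadratic term is at most [c / 2], so the subtracted constant absorbs it
    together with the lower bound [- (phi1 1 / 2)] of [Phi1]; beyond 1 the bound is that of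
    [Phi2_ge]. *)
Lemma Psi_sqr_ge (phi1 phi2 : R -> R) (c C r : R) (y : R) :
  2 <= r ->
  {within `[0, 1], continuous phi1} ->
  (forall t : R, 0 <= t -> 0 <= phi1 t) ->
  {in `[0, 1] &, {homo phi1 : x y / x <= y}} ->
  {within `[1, +oo[, continuous phi2} ->
  0 < c ->
  (forall t : R, 1 <= t ->
     c * t `^ ((r - 2) / 2) <= phi2 t <= C * (1 + t `^ ((r - 2) / 2))) ->
  c / 2 * y ^+ 2 - (phi1 1 + c) / 2 <= Psi phi1 phi2 (y ^+ 2).
Proof.
move=> ge2r phi1_cont phi1_ge0 phi1_incr phi2_cont c_gt0 phi2_growth.
have phi11 := phi1_ge0 _ ler01.
rewrite /Psi; case: (leP (y ^+ 2) 1) => y1.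
  have := Phi1_bounds (t := y ^+ 2) phi1_cont phi1_ge0 phi1_incr.
  rewrite sqr_ge0 y1 => /(_ isT) /andP[? ?].
  by nra.
by have := Phi2_ge ge2r c_gt0 phi2_cont phi2_growth (ltW y1); nra.
Qed.

End constitutive.

(** * The energy on constants *)

Section energy_on_constants.
Context {R : realType} (a b : R).
Local Notation mu := (@lebesgue_measure R).
Local Notation D := (`]a, b[%classic : set (measurableTypeR R)).

Lemma ae_eq_Rintegral (f g : R -> R) :
  measurable_fun D f -> measurable_fun D g -> ae_eq mu D f g ->
  \int[mu]_(x in D) f x = \int[mu]_(x in D) g x.
Proof.
move=> mf mg fg; congr fine; apply: ae_eq_integral.
- exact: measurable_oo.
- exact/measurable_EFinP.
- exact/measurable_EFinP.
- exact: (ae_eq_comp EFin fg).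
Qed.

(** This is the energy at the constant [t]. The density [H], later [Psi phi1 phi2 (y ^+ 2)], is kept
    abstract: only its continuity and its upper and lower growth bounds enter. *)
Definition shifted_energy (H f uhat : R -> R) (t : R) : R :=
  \int[mu]_(x in D) H (t + uhat x) - pairing D f (fun x => t + uhat x).

Lemma comp_shift_measurable (H uhat v : R -> R) (r : R) :
  continuous H -> Lp D r uhat ->
  measurable_fun D v -> measurable_fun D (fun x => H (v x + uhat x)).
Proof.
move=> H_cont Lu mv; apply: (measurableT_comp (continuous_measurable_fun H_cont)).
exact: measurable_funD mv (Lp_measurable (measurable_oo a b) Lu).
Qed.

Lemma shifted_energy_ae (H f uhat : R -> R) (r : R) (v : R -> R) (t : R) :
  continuous H -> Lp D (conj_exp r) f -> Lp D r uhat ->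
  measurable_fun D v ->
  ae_eq mu D v (cst t) ->
  \int[mu]_(x in D) H (v x + uhat x) - pairing D f (fun x => v x + uhat x) =
  shifted_energy H f uhat t.
Proof.
move=> H_cont Lf Lu mv vt; have mf := Lp_measurable (measurable_oo a b) Lf.
have muhat := Lp_measurable (measurable_oo a b) Lu.
have mt : measurable_fun D (cst t : R -> R) by [].
congr (_ - _); apply: ae_eq_Rintegral.
- exact: (comp_shift_measurable H_cont Lu).
- exact: (comp_shift_measurable H_cont Lu mt).
- by apply: filterS vt => x + Dx => /(_ Dx) ->.
- exact: measurable_funM mf (measurable_funD mv muhat).
- exact: measurable_funM mf (measurable_funD mt muhat).
- by apply: filterS vt => x + Dx => /(_ Dx) ->.
Qed.

(** As [|t + y|] is at most twice the larger of [K] and [|y|], its power is at most the sum of the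
    two powers. The bound is uniform in [|t| <= K], as a dominating function must be. *)
Lemma powR_growth_shift (H : R -> R) (r L C : R) (K t y : R) :
  2 <= r -> 0 <= C -> (forall y, `|H y| <= L + C * `|y| `^ r) ->
  `|t| <= K ->
  `|H (t + y)| <= L + C * ((2 * K) `^ r + 2 `^ r * `|y| `^ r).
Proof.
move=> ge2r C_ge0 H_le tK; have r0 : 0 <= r by lra.
have K0 : 0 <= K by exact: le_trans tK.
rewrite (le_trans (H_le _))// lerD2l ler_wpM2l//.
have ty : `|t + y| <= K + `|y| by rewrite (le_trans (ler_normD _ _))// lerD2r.
have [yK|Ky] := leP `|y| K.
  rewrite (@le_trans _ _ ((2 * K) `^ r))//.
    by rewrite ge0_ler_powR ?nnegrE//; lra.
  by rewrite lerDl mulr_ge0 ?powR_ge0.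
rewrite (@le_trans _ _ ((2 * `|y|) `^ r))//.
  by rewrite ge0_ler_powR ?nnegrE//; lra.
by rewrite [leLHS]powRM// lerDr powR_ge0.
Qed.

Lemma powR_growth_integrable (uhat : R -> R) (r L C : R) (K : R) :
  2 <= r -> Lp D r uhat ->
  mu.-integrable D
  (EFin \o (fun x => L + C * ((2 * K) `^ r + 2 `^ r * `|uhat x| `^ r))).
Proof.
move=> ge2r Lu.
have r1 : 1 <= r by lra.
have iu := Lp_powR_integrable (measurable_oo a b) r1 Lu.
have i1 := integrable_cst_oo a b (L + C * (2 * K) `^ r).
have i2 := integrableZl (measurable_oo a b) (C * 2 `^ r) iu.
apply: eq_integrable (integrableD (measurable_oo a b) i1 i2) => //.
move=> x _ /=; rewrite -EFinM -EFinD; congr EFin; ring.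
Qed.

Lemma shifted_integrable (H uhat : R -> R) (r L C : R) (t : R) :
  continuous H -> 2 <= r -> 0 <= C ->
  (forall y, `|H y| <= L + C * `|y| `^ r) -> Lp D r uhat ->
  mu.-integrable D (EFin \o (fun x => H (t + uhat x))).
Proof.
move=> H_cont ge2r C_ge0 H_le Lu.
apply: (le_integrable (measurable_oo a b) _ _ (powR_growth_integrable L C `|t| ge2r Lu)).
  by apply/measurable_EFinP; apply: (@comp_shift_measurable H uhat (cst t) r).
move=> x _ /=; rewrite lee_fin (le_trans (powR_growth_shift _ ge2r C_ge0 H_le
  (lexx _)))//.
exact: ler_norm.
Qed.

Lemma shifted_dissipation_continuous (H uhat : R -> R) (r L C : R) :
  continuous H -> 2 <= r -> 0 <= C ->
  (forall y, `|H y| <= L + C * `|y| `^ r) -> Lp D r uhat ->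
  continuous (fun t => \int[mu]_(x in D) H (t + uhat x)).
Proof.
move=> H_cont ge2r C_ge0 H_le Lu t0.
have t0I : t0 \in `]t0 - 1, t0 + 1[%classic by rewrite inE/= in_itv/=; lra.
(* Parameters within distance 1 of [t0] satisfy [|t| <= |t0| + 1], which fixes the value of [K] in
   the dominating function. *)
apply: (continuity_under_integral (mu := mu) (B := D)
  (f := fun t x => H (t + uhat x)) (u := t0 - 1) (v := t0 + 1)
  (measurable_oo a b) _ _ (powR_growth_integrable L C (`|t0| + 1) ge2r Lu) _ t0I).
- by move=> t _; exact: (shifted_integrable _ H_cont ge2r C_ge0 H_le Lu).
- apply: aeW => x _ t _; apply: (@continuous_comp _ _ _ (fun t => t + uhat x) H).
    by apply: cvgD; [exact: cvg_id|exact: cvg_cst].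
  exact: H_cont.
- move=> t /=; rewrite in_itv/= => /andP[t1 t2]; apply: aeW => x _.
  apply: (powR_growth_shift _ ge2r C_ge0 H_le); rewrite ler_norml.
  have := ler_norm t0; have := ler_norm (- t0); rewrite normrN.
  by move=> ? ?; apply/andP; split; lra.
Qed.

Lemma pairing_shift (f uhat : R -> R) (r : R) (t : R) :
  2 <= r -> Lp D (conj_exp r) f -> Lp D r uhat ->
  pairing D f (fun x => t + uhat x) =
  t * \int[mu]_(x in D) f x + pairing D f uhat.
Proof.
move=> ge2r Lf Lu.
have s1 := conj_exp_ge1 ge2r.
have iff_ := Lp_integrable s1 Lf.
have ifu : mu.-integrable D (EFin \o (fun x => f x * uhat x)).
  apply: (@Lp_mul_integrable _ _ _ (conj_exp r) r) => //; [lra|lra|].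
  by rewrite /conj_exp; field; lra.
rewrite /pairing; under eq_Rintegral do rewrite mulrDr (mulrC _ t).
rewrite RintegralD//; last exact: (integrableZl (measurable_oo a b) t iff_).
by rewrite RintegralZl.
Qed.

Lemma shifted_energy_continuous (H f uhat : R -> R) (r L C : R) :
  continuous H -> 2 <= r -> 0 <= C ->
  (forall y, `|H y| <= L + C * `|y| `^ r) -> Lp D (conj_exp r) f -> Lp D r uhat ->
  continuous (shifted_energy H f uhat).
Proof.
move=> H_cont ge2r C_ge0 H_le Lf Lu t; apply: cvgB.
  exact: (shifted_dissipation_continuous H_cont ge2r C_ge0 H_le Lu).
under eq_fun do rewrite (pairing_shift _ ge2r Lf Lu); rewrite (pairing_shift _ ge2r Lf Lu).
apply: cvgD; last exact: cvg_cst.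
by apply: cvgMl.
Qed.

(* A quadratic lower bound dominates N |y| - B' for every slope N; N is chosen to
   beat the linear term of the energy. *)
Lemma shifted_energy_coercive (H f uhat : R -> R) (r L C : R) (A B : R) :
  continuous H -> 2 <= r -> 0 <= C ->
  (forall y, `|H y| <= L + C * `|y| `^ r) -> Lp D (conj_exp r) f -> Lp D r uhat ->
  a < b -> 0 < A ->
  (forall y, A * y ^+ 2 - B <= H y) ->
  exists Q, forall t, `|t| - Q <= shifted_energy H f uhat t.
Proof.
move=> H_cont ge2r C_ge0 H_le Lf Lu ab A0 H_ge; have ba0 : 0 < b - a by lra.
have r1 : 1 <= r by lra.
set F := \int[mu]_(x in D) f x.
(* Integrated over the interval, slope [N] becomes [|F| + 1]: the load uses up [|F|] and slope 1
   remains. *)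
pose N := (`|F| + 1) / (b - a).
(* The added term completes the square in [A * z ^+ 2 - N * z]. *)
pose B' := B + N ^+ 2 / (4 * A).
have N0 : 0 <= N by rewrite divr_ge0// ltW.
have Hlin y : N * `|y| - B' <= H y.
  apply: le_trans (H_ge y).
  rewrite -real_normK ?num_real// -subr_ge0.
  rewrite [leRHS](_ : _ = A * (`|y| - N / (2 * A)) ^+ 2); last first.
    by rewrite /B'; field; lra.
  by rewrite mulr_ge0 ?sqr_ge0// ltW.
have iu := Lp_integrable r1 Lu.
have iau : mu.-integrable D (EFin \o (fun x => `|uhat x|)) by exact: integrable_norm.
pose U := \int[mu]_(x in D) `|uhat x|.
exists (N * U + B' * (b - a) + pairing D f uhat) => t.
rewrite /shifted_energy (pairing_shift _ ge2r Lf Lu) -/F.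
have : (N * `|t| - B') * (b - a) - N * U <= \int[mu]_(x in D) H (t + uhat x).
  rewrite /U -RintegralZl// -(Rintegral_oo_cst _ (ltW ab)) -RintegralB//; last 2 first.
  - exact: integrable_cst_oo.
  - exact: (integrableZl (measurable_oo a b) N iau).
  apply: le_Rintegral => //.
  - exact: (integrableB (measurable_oo a b)
      (integrable_cst_oo a b (N * `|t| - B'))
      (integrableZl (measurable_oo a b) N iau)).
  - exact: (shifted_integrable _ H_cont ge2r C_ge0 H_le Lu).
  move=> x _; apply: le_trans (Hlin _).
  have : `|t| - `|uhat x| <= `|t + uhat x| by exact: lerB_normD.
  move: `|t + _| => z zt; nra.
have -> : (N * `|t| - B') * (b - a) = (`|F| + 1) * `|t| - B' * (b - a).
  by rewrite /N; field; lra.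
have : t * F <= `|F| * `|t| by rewrite mulrC -normrM ler_norm.
move: (Rintegral _ _ _) (pairing _ _ _) => I P.
lra.
Qed.

Lemma shifted_energy_min (H f uhat : R -> R) (r L C : R) (A B : R) :
  continuous H -> 2 <= r -> 0 <= C ->
  (forall y, `|H y| <= L + C * `|y| `^ r) -> Lp D (conj_exp r) f -> Lp D r uhat ->
  a < b -> 0 < A ->
  (forall y, A * y ^+ 2 - B <= H y) ->
  exists t0, forall t, shifted_energy H f uhat t0 <= shifted_energy H f uhat t.
Proof.
move=> H_cont ge2r C_ge0 H_le Lf Lu ab A0 H_ge.
have [Q JQ] := shifted_energy_coercive H_cont ge2r C_ge0 H_le Lf Lu ab A0 H_ge.
(* If [|t| > M], then [|t| - Q] exceeds the energy at 0. As 0 lies in [[- M, M]], a minimum over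
   this compact interval is global. *)
pose M := `|Q + shifted_energy H f uhat 0|.
have MM : - M <= M by rewrite ge0_cp// normr_ge0.
have [|t0 _ t0min] := @EVT_min _ (shifted_energy H f uhat) _ _ MM.
  apply: continuous_subspaceT.
  exact: (shifted_energy_continuous H_cont ge2r C_ge0 H_le Lf Lu).
exists t0 => t; have [tM|Mt] := leP `|t| M.
  by apply: t0min; rewrite in_itv/= -ler_norml.
apply: (@le_trans _ _ (shifted_energy H f uhat 0)).
  by apply: t0min; rewrite in_itv/= oppr_le0 normr_ge0.
apply: le_trans (JQ t); have := ler_norm (Q + shifted_energy H f uhat 0).
by rewrite /M in Mt; lra.
Qed.

End energy_on_constants.

(** * Constants in V *)

Section constants_in_V.
Context {R : realType} (a b : R).
Local Notation mu := (@lebesgue_measure R).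
Local Notation D := (`]a, b[%classic : set (measurableTypeR R)).

Lemma V0 (Sp : set R) (r : R) : 2 <= r -> V a b Sp r (cst 0).
Proof.
move=> r2; split.
  by apply: (@bounded_Lp _ _ _ _ 0) => //; [lra|move=> x _; rewrite normr0].
move=> psi dpsi _; rewrite /pairing; under eq_Rintegral do rewrite mulr0.
by rewrite Rintegral_cst ?mul0r//; exact: (measurable_oo a b).
Qed.

(** Orthogonality of [phi] reads [m] times the integral of [dpsi] is zero. Dividing by [m] leaves a
    condition free of [m], which is exactly what any constant needs. *)
Lemma V_cst (Sp : set R) (r m k : R) (phi : R -> R) : 2 <= r -> m != 0 ->
  V a b Sp r phi -> ae_eq mu D phi (cst m) -> V a b Sp r (cst k).
Proof.
move=> r2 m0 [Lphi phi0] phim; split.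
  by apply: (@bounded_Lp _ _ _ _ `|k|) => //; lra.
move=> psi dpsi W; have [[_ _ Ldpsi _] _ _] := W.
have idpsi := Lp_integrable (conj_exp_ge1 r2) Ldpsi.
have mdpsi := Lp_measurable (measurable_oo a b) Ldpsi.
have : pairing D dpsi phi = \int[mu]_(x in D) dpsi x * m.
  rewrite -RintegralZr//; apply: ae_eq_Rintegral.
  - exact: measurable_funM mdpsi (Lp_measurable (measurable_oo a b) Lphi).
  - exact: measurable_funM mdpsi (measurable_cst _).
  - by apply: filterS phim => x + Dx => /(_ Dx) ->.
rewrite (phi0 _ _ W) => /esym/eqP; rewrite mulf_eq0 (negbTE m0) orbF => /eqP I0.
by rewrite /pairing RintegralZr// I0 mul0r.
Qed.

End constants_in_V.

(** * Existence and uniqueness of local minimizers *)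

Theorem theorem4p8 (R : realType) (a b : R) (Sv Sp : set R) (r : R)
  (q u0 f0 uhat phi1 phi2 : R -> R) (c C : R)
  (ltab : a < b)
  (SvSp0 : Sv `&` Sp = set0)
  (SvSpU : Sv `|` Sp = [set a; b])
  (ge2r : 2 <= r)
  (Lq : Lp `]a, b[ r q)
  (Lf0 : Lp `]a, b[ (conj_exp r) f0)
  (uhatP : is_uhat a b Sv Sp r q u0 uhat)
  (phi1_ge0 : forall t : R, 0 <= t -> 0 <= phi1 t)
  (phi2_ge0 : forall t : R, 0 <= t -> 0 <= phi2 t)
  (phi1_cont : {within `[0, 1], continuous phi1})
  (phi1_incr : {in `[0, 1] &, {homo phi1 : x y / x <= y}})
  (phi2_cont : {within `[1, +oo[, continuous phi2})
  (phi2_incr : {in `[1, +oo[ &, {homo phi2 : x y / x <= y}})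
  (c_gt0 : 0 < c) (C_gt0 : 0 < C)
  (phi2_growth : forall t : R, 1 <= t ->
     c * t `^ ((r - 2) / 2) <= phi2 t <= C * (1 + t `^ ((r - 2) / 2)))
  (lambda12 : phi1 1 > phi2 1) :
  let M := local_minimizers (V a b Sp r) (energy a b phi1 phi2 f0 uhat) in
  (Vol0 Sv = 0%E -> exists v, M v) /\
  ((0 < Vol0 Sv)%E ->
     exists2 v, M v &
       forall w, M w -> ae_eq (@lebesgue_measure R) [set` `]a, b[] w v).
Proof.
move=> M.
have Spab : Sp `<=` [set a; b] by rewrite -SvSpU; exact: subsetUr.
have [Lu _] := uhatP.
pose H := fun y : R => Psi phi1 phi2 (y ^+ 2).
have H_cont : continuous H := Psi_sqr_continuous phi1_cont phi2_cont.
have H_le y : `|H y| <= phi1 1 + C * `|y| `^ r.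
  exact: (Psi_sqr_le y ge2r phi1_cont phi1_ge0 phi1_incr phi2_cont phi2_incr
            c_gt0 C_gt0 phi2_growth).
have H_ge y : c / 2 * y ^+ 2 - (phi1 1 + c) / 2 <= H y.
  exact: (Psi_sqr_ge y ge2r phi1_cont phi1_ge0 phi1_incr phi2_cont c_gt0
            phi2_growth).
have energyE v t : measurable_fun [set` `]a, b[] v ->
    ae_eq (@lebesgue_measure R) [set` `]a, b[] v (cst t) ->
    energy a b phi1 phi2 f0 uhat v = shifted_energy a b H f0 uhat t.
  exact: shifted_energy_ae H_cont Lf0 Lu.
have Vae phi : V a b Sp r phi ->
    exists m, ae_eq (@lebesgue_measure R) [set` `]a, b[] phi (cst m).
  by move=> Vphi; eexists; exact: (V_ae_mean ltab Spab ge2r Vphi).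
(* Every competitor [k + d * phi] is almost everywhere the constant [k + d * m], so a comparison of
   constants suffices. It holds for all [d], hence [eta = 1] will do. *)
have Mcst k : V a b Sp r (cst k) ->
    (forall phi m d, V a b Sp r phi ->
      ae_eq (@lebesgue_measure R) [set` `]a, b[] phi (cst m) ->
      shifted_energy a b H f0 uhat k <= shifted_energy a b H f0 uhat (k + d * m)) ->
    M (cst k).
  move=> Vk kmin; split => //; exists 1 => // phi Vphi d _.
  have [m phim] := Vae _ Vphi.
  have mphi := Lp_measurable (measurable_oo a b) Vphi.1.
  rewrite (energyE (cst k) k)//; last exact: aeW.
  rewrite (energyE _ (k + d * m)); first exact: kmin Vphi phim.
    apply: measurable_funD => //.
    exact: measurable_funM (measurable_cst d) mphi.
  by apply: filterS phim => x + Dx => /(_ Dx) ->.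
have [v Mv] : exists v, M v.
  (* Either some element of [V] is a nonzero constant almost everywhere, and then all constants are
     in [V] and the global minimizer [k] is available; or all directions vanish almost everywhere
     and leave the energy unchanged. *)
  have [[phi [m [m0 [Vphi phim]]]]|none] := pselect (exists phi m, m != 0 /\
    V a b Sp r phi /\ ae_eq (@lebesgue_measure R) [set` `]a, b[] phi (cst m)).
    have c2 : 0 < c / 2 by rewrite divr_gt0.
    have [k kmin] := shifted_energy_min H_cont ge2r (ltW C_gt0) H_le Lf0 Lu
      ltab c2 H_ge.
    by exists (cst k); apply: Mcst => //; exact: V_cst ge2r m0 Vphi phim.
  exists (cst 0); apply: Mcst; first exact: V0.
  move=> phi m d Vphi phim; have [->|m0] := eqVneq m 0; first by rewrite mulr0 addr0.
  by case: none; exists phi, m.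
split=> [_|/Vol0_gt0[s Svs]]; first by exists v.
(* The point [s] of [Sv] is an endpoint, and disjointness keeps it out of [Sp]. *)
have nSp : ~ (Sp a /\ Sp b).
  move=> [Spa Spb]; suff : (Sv `&` Sp) s by rewrite SvSp0.
  split=> //; have : [set a; b] s by rewrite -SvSpU; left.
  by move=> [->|->].
have Vae0 phi : V a b Sp r phi ->
    ae_eq (@lebesgue_measure R) [set` `]a, b[] phi (cst 0).
  move=> Vphi; have := V_ae_mean ltab Spab ge2r Vphi.
  by rewrite (V_mean_eq0 ltab Spab nSp ge2r Vphi) mul0r.
exists v => // w Mw.
apply: (ae_eq_trans (Vae0 _ Mw.1)); apply: ae_eq_sym; exact: (Vae0 _ Mv.1).
Qed.
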